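(* Let $f,g:\mathbb{R}^n\to\mathbb{R}\cup\{+\infty\}$ be closed convex proper functions such that there exist $x^\star,u^\star\in\mathbb{R}^n$ with $0\in\partial f(x^\star)+u^\star$ and $0\in\partial g^*(u^\star)-x^\star$. Let $\alpha>0$, let $x^0,u^0\in\mathbb{R}^n$, and let $\{(x^k,u^k)\}_{k\ge 0}$ be generated by $$u^{k+1}=\mathrm{prox}_{\alpha^{-1}g^*}\big(u^k+\tfrac1\alpha x^k\big),\qquad x^{k+1}=\mathrm{prox}_{\alpha f}\big(x^k-\alpha(2u^{k+1}-u^k)\big),\qquad k=0,1,2,\dots$$ For each integer $K\ge 1$ put $\bar x^K=\frac1K\sum_{k=1}^K x^k$ and $\bar u^K=\frac1K\sum_{k=1}^K u^k$. Then for all integers $K\ge1$, all $x\in\mathrm{dom}\, f$ and all $u\in\mathrm{dom}\, g^*$, $$\mathcal{L}(\bar x^K,u)-\mathcal{L}(x,\bar u^K)\le\frac{1}{\alpha(K+1)}\left(\|x^0-x\|^2+\alpha^2\|u^0-u\|^2\right).$$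
   Context: $\langle\cdot,\cdot\rangle$ and $\|\cdot\|$ are the standard inner product and Euclidean norm on $\mathbb{R}^n$. $g^*(y)=\sup_x\{\langle y,x\rangle-g(x)\}$ is the Fenchel conjugate, $\partial$ the convex subdifferential, and $\mathrm{prox}_\varphi(x)=\arg\min_{y}\{\varphi(y)+\frac12\|y-x\|^2\}$. The Lagrangian is $\mathcal{L}(x,u)=f(x)+\langle u,x\rangle-g^*(u)$. The iteration is the Douglas--Rachford splitting algorithm (variant DRS-$gf$) for minimizing $f+g$. *)

(* Defs.v *)
From HB Require Import structures.
From mathcomp Require Import all_boot all_order all_algebra.
From mathcomp Require Import all_classical all_reals all_analysis.

Set Implicit Arguments.
Unset Strict Implicit.
Unset Printing Implicit Defensive.

Import Order.TTheory GRing.Theory Num.Theory.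
Import numFieldNormedType.Exports.

Local Open Scope classical_set_scope.
Local Open Scope ring_scope.

Section convex_analysis.
Context {R : realType} {n : nat}.
Local Notation V := 'rV[R]_n.
Implicit Types (f g : V -> \bar R) (x y u : V).

Definition dot x y : R := \sum_(i < n) x 0 i * y 0 i.

(* The library norm `|x| on row vectors is the sup norm, hence this one. *)
Definition enorm x : R := Num.sqrt (dot x x).

Definition dom f : set V := [set x | (f x < +oo)%E].

Definition epigraph f : set (V * R) := [set p | (f p.1 <= p.2%:E)%E].

(* f takes its values in R \cup {+oo} and is not identically +oo *)
Definition proper_function f : Prop := (forall x, f x != -oo%E) /\ dom f !=set0.

Definition convex_ereal f : Prop :=
  forall x y (t : R), 0 < t -> t < 1 ->
    (f (t *: x + (1 - t) *: y)%R <= t%:E * f x + (1 - t)%:E * f y)%E.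

(* The topology on V is the product one, i.e. the Euclidean topology. *)
Definition closed_convex_proper f : Prop :=
  [/\ closed (epigraph f), convex_ereal f & proper_function f].

Definition conjugate g : V -> \bar R :=
  fun y => ereal_sup [set ((dot y x)%:E - g x)%E | x in [set: V]].

Definition subdifferential f x : set V :=
  [set v | forall y, (f x + (dot v (y - x)%R)%:E <= f y)%E].

Definition argmin (h : V -> \bar R) : set V :=
  [set y | forall z, (h y <= h z)%E].

(* For f closed, convex and proper the argmin is a singleton, so that
   xget returns its element; otherwise the value of prox is irrelevant. *)
Definition prox f x : V :=
  xget 0 (argmin (fun y => (f y + (2^-1 * enorm (y - x) ^+ 2)%:E)%E)).

(* Meaningful when f x and conjugate g u are not both +oo: the library sets
   +oo - +oo = -oo. *)
Definition lagrangian f g x u : \bar R :=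
  (f x + (dot u x)%:E - conjugate g u)%E.

Definition ergodic_mean (z : nat -> V) (K : nat) : V :=
  K%:R^-1 *: \sum_(1 <= k < K.+1) z k.

End convex_analysis.

(* Main.v *)
Require Import Defs.
From mathcomp Require Import all_boot all_order all_algebra.
From mathcomp Require Import all_classical all_reals all_analysis.
From mathcomp Require Import ring lra.

Import Order.TTheory GRing.Theory Num.Theory.
Import numFieldNormedType.Exports.

Local Open Scope classical_set_scope.
Local Open Scope ring_scope.

(** The proof works in real numbers with the epigraphs of [f] and of
[conjugate g], which are closed convex sets.

With r_k = (x_k - y) + alpha (u_k - v), the optimality conditions of the two
proximal steps add up to a one-step bound in which all bilinear coupling terms
cancel: the primal-dual gap at (x_{k+1}, u_{k+1}) is at most
alpha^-1 <r_k - r_{k+1}, r_{k+1}> ([drs_step_gap]). Summing this by the plain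
telescoping 2 <a - b, b> <= |a|^2 - |b|^2 would only give the constant 1/K. The
terms |r_k - r_{k+1}|^2 dropped there cannot all be small while |r_K| is small:
by Cauchy-Schwarz their sum plus |r_K|^2 is at least |r_0|^2 / (K + 1), which
improves the bound on the sum to K / (2 (K + 1)) |r_0|^2
([sum_dot_increments_le]). Jensen's inequality transfers the average of the
gaps to the ergodic means ([ergodic_mean_in_convex]), and
|r_0|^2 <= 2 (|x_0 - y|^2 + alpha^2 |u_0 - v|^2) ends the proof.

Since [prox] is a choice of a minimizer with a default value, the optimality
conditions hold only once a minimizer is known to exist
([prox_objective_min]). Existence needs an affine minorant of the function: for
[f] it is the subgradient at the given saddle point, for [conjugate g] it comes
from any point of the domain of [g]. *)

(** * The inner product *)

Section inner_product.
Context {R : realType} {n : nat}.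
Implicit Types (a b c x y z : 'rV[R]_n).

Lemma dotC a b : dot a b = dot b a.
Proof. by apply: eq_bigr => i _; rewrite mulrC. Qed.

Lemma dotDl a b c : dot (a + b) c = dot a c + dot b c.
Proof. by rewrite -big_split; apply: eq_bigr => i _; rewrite mxE mulrDl. Qed.

Lemma dotZl (k : R) a c : dot (k *: a) c = k * dot a c.
Proof. by rewrite mulr_sumr; apply: eq_bigr => i _; rewrite mxE mulrA. Qed.

Lemma dotNl a c : dot (- a) c = - dot a c.
Proof. by rewrite -scaleN1r dotZl mulN1r. Qed.

Lemma dotDr a b c : dot c (a + b) = dot c a + dot c b.
Proof. by rewrite dotC dotDl !(dotC c). Qed.

Lemma dotZr (k : R) a c : dot c (k *: a) = k * dot c a.
Proof. by rewrite dotC dotZl dotC. Qed.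

Lemma dotNr a c : dot c (- a) = - dot c a.
Proof. by rewrite dotC dotNl dotC. Qed.

Definition dotE := (dotDl, dotDr, dotZl, dotZr, dotNl, dotNr).

Lemma dot_ge0 a : 0 <= dot a a.
Proof. by apply: sumr_ge0 => i _; rewrite -expr2 sqr_ge0. Qed.

Lemma enorm_sqr a : enorm a ^+ 2 = dot a a.
Proof. by rewrite sqr_sqrtr ?dot_ge0. Qed.

Lemma coord_sqr_le_dot a i : a 0 i ^+ 2 <= dot a a.
Proof.
rewrite /dot (bigD1 i) //= -expr2 lerDl.
by apply: sumr_ge0 => j _; rewrite -expr2 sqr_ge0.
Qed.

Lemma cvg_dot (T : Type) (F : set_system T) (FF : Filter F)
    (a b : T -> 'rV[R]_n) (la lb : 'rV[R]_n) :
  a @ F --> la -> b @ F --> lb -> dot (a t) (b t) @[t --> F] --> dot la lb.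
Proof.
move=> ha hb; apply: (@cvg_big R _ +%R 0 xpredT (@add_continuous R)) => i _.
apply: cvgM.
  exact: (cvg_comp _ _ ha (@coord_continuous R 1 n 0 i la)).
exact: (cvg_comp _ _ hb (@coord_continuous R 1 n 0 i lb)).
Qed.
End inner_product.

(** * Minimizing a linear plus quadratic function over a closed convex set *)

Section epigraph_minimization.
Context {R : realType} {n : nat}.
Local Notation V := 'rV[R]_n.
Implicit Types (E : set (V * R)).

(** Convexity restricted to 0 < t < 1, to match that of extended real functions,
so that it transfers to epigraphs without handling products with 0. *)
Definition convex_pairs E : Prop :=
  forall p q (t : R), 0 < t -> t < 1 -> E p -> E q ->
    E (t *: p.1 + (1 - t) *: q.1, t * p.2 + (1 - t) * q.2).

Lemma epigraph_convex (phi : V -> \bar R) :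
  convex_ereal phi -> convex_pairs (epigraph phi).
Proof.
move=> cphi p q t t0 t1 Ep Eq; rewrite /epigraph /=.
apply: (le_trans (cphi _ _ _ t0 t1)).
rewrite [leRHS]EFinD; apply: leeD; rewrite EFinM; apply: lee_wpmul2l => //;
  by rewrite lee_fin ?subr_ge0 ltW.
Qed.

(** On the point [(y, phi y)] of an epigraph this is the function
c * phi + 1/2 |. - x|^2 that [prox] minimizes; taking the value as a separate
variable keeps it real and continuous. *)
Definition prox_objective (c : R) (x : V) (p : V * R) : R :=
  c * p.2 + 2^-1 * dot (p.1 - x) (p.1 - x).

(** Strong convexity replaces compactness: the midpoint of two almost minimizers
p and q has objective at least the infimum, and by the parallelogram law lies
|p.1 - q.1|^2 / 8 below the mean of their objectives. So the first components
of a minimizing sequence form a Cauchy sequence, and the second components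
converge because the objective values do. The affine minorant makes the infimum
finite. *)
Lemma prox_objective_min E c x : 0 < c -> closed E -> convex_pairs E ->
    E !=set0 -> (exists a b, forall p, E p -> dot a p.1 + b <= c * p.2) ->
  exists2 p, E p & forall q, E q -> prox_objective c x p <= prox_objective c x q.
Proof.
move=> c0 clE cE [p0 Ep0] [a [b hab]].
pose F := prox_objective c x.
pose S := [set F p | p in E].
have lbS : has_lbound S.
  (* [c * t] is at least [dot a y + b]; then complete the square in y. *)
  exists (dot a x + b - 2^-1 * dot a a) => _ [p Ep <-]; rewrite /F /prox_objective.
  have := hab p Ep; have := dot_ge0 (p.1 - x + a).
  by rewrite !dotE (dotC x a) (dotC p.1 a) (dotC p.1 x); lra.
have hS : has_inf S by split=> //; exists (F p0), p0.
pose m := inf S.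
have mF q : E q -> m <= F q by move=> Eq; apply: ge_inf => //; exists q.
have /choice[p hp] : forall k : nat, exists q, E q /\ F q < m + k.+1%:R^-1.
  move=> k; have [|_ [q Eq <-] lt] := @inf_adherent _ S k.+1%:R^-1 _ hS.
    by rewrite invr_gt0.
  by exists q.
have Ep k := (hp k).1; have Fp k := (hp k).2.
have close j k : dot ((p j).1 - (p k).1) ((p j).1 - (p k).1)
    <= 4 * (j.+1%:R^-1 + k.+1%:R^-1).
  have h0 : (0 : R) < 2^-1 by lra.
  have h1 : (2^-1 : R) < 1 by lra.
  have := mF _ (cE _ _ _ h0 h1 (Ep j) (Ep k)).
  have := Fp j; have := Fp k; rewrite /F /prox_objective /= !dotE.
  rewrite !(dotC x) (dotC (p k).1 (p j).1).
  move: (j.+1%:R^-1) (k.+1%:R^-1) => ej ek. lra.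
have cv1 : cvg ((fun k => (p k).1) @ \oo).
  apply: cauchy_cvg; apply: cauchy_exP => e e0.
  have e8 : 0 < e ^+ 2 / 8 by rewrite divr_gt0 ?exprn_gt0.
  have [N _ hN] : \forall k \near \oo, k.+1%:R^-1 < e ^+ 2 / 8.
    have := @cvgr_lt _ _ _ _ _ _ (@cvg_harmonic R) (e^+2/8).
    by apply.
  exists (p N).1; exists N => // k Nk.
  split=> // i j; rewrite ord1.
  have h := coord_sqr_le_dot ((p N).1 - (p k).1) j.
  rewrite !mxE in h.
  rewrite /ball /= -(@ltr_sqr _ `|_|) ?nnegrE ?(ltW e0) // real_normK ?num_real //.
  apply: (le_lt_trans h); apply: (le_lt_trans (close N k)).
  have := hN N (leqnn N); have := hN k Nk; rewrite /=.
  move: (N.+1%:R^-1) (k.+1%:R^-1) => ej ek. lra.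
pose l := lim ((fun k => (p k).1) @ \oo).
have Fm : F (p k) @[k --> \oo] --> m.
  apply: (@squeeze_cvgr _ _ _ _ (fun=> m) (fun k => m + k.+1%:R^-1)).
  - by near=> k; rewrite mF //= ltW.
  - exact: cvg_cst.
  - rewrite -[X in _ --> X]addr0.
    by apply: cvgD; [exact: cvg_cst|exact: cvg_harmonic].
have cv1x : ((p k).1 - x) @[k --> \oo] --> l - x.
  by apply: cvgB; [exact: cv1|exact: cvg_cst].
pose s := (m - 2^-1 * dot (l - x) (l - x)) / c.
have cv2 : (p k).2 @[k --> \oo] --> s.
  have -> : (fun k => (p k).2) =
      (fun k => (F (p k) - 2^-1 * dot ((p k).1 - x) ((p k).1 - x)) / c).
    apply/funext => k; rewrite /F /prox_objective addrK mulrC mulKf //.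
    by rewrite gt_eqF.
  apply: cvgM; last exact: cvg_cst.
  apply: cvgB => //; apply: cvgM; first exact: cvg_cst.
  exact: cvg_dot.
have El : E (l, s).
  have cvp : ((p k).1, (p k).2) @[k --> \oo] --> (l, s).
    exact: (@cvg_pair _ _ _ \oo (nbhs l) (nbhs s) _ _ _ _ _ cv1 cv2).
  apply: (@closed_cvg _ _ \oo _ (fun k => ((p k).1, (p k).2)) E clE _ _ cvp).
  by near=> k; have := Ep k; case: (p k).
exists (l, s) => // q Eq; apply: le_trans (mF q Eq).
by rewrite /prox_objective /= /s mulrC divfK ?gt_eqF // subrK.
Unshelve. all: by end_near.
Qed.
End epigraph_minimization.

(** * Optimality conditions of proximal steps *)

Section prox.
Context {R : realType} {n : nat}.
Local Notation V := 'rV[R]_n.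
Implicit Types (E : set (V * R)) (phi g : V -> \bar R) (x y u : V).

(** On the segment from p to a competitor q, the objective changes by
t D + t^2 |q.1 - p.1|^2 / 2, where D is the difference of the two sides; a
negative D would make p suboptimal for small t. *)
Lemma prox_objective_variational E c x p : convex_pairs E -> E p ->
    (forall q, E q -> prox_objective c x p <= prox_objective c x q) ->
  forall q, E q -> c * p.2 + dot (x - p.1) (q.1 - p.1) <= c * q.2.
Proof.
move=> cE Ep minp q Eq.
rewrite -subr_ge0; set D := _ - _; rewrite leNgt; apply/negP => D0.
pose N := dot (q.1 - p.1) (q.1 - p.1).
have N0 : 0 <= N := dot_ge0 _.
(* t < 1 and t * N <= - D, so that D + t * N / 2 is still negative. *)
pose t := - D / (N - D + 1).
have den : 0 < N - D + 1 by lra.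
have t0 : 0 < t by rewrite divr_gt0 // oppr_gt0.
have t1 : t < 1 by rewrite ltr_pdivrMr //; lra.
have := minp _ (cE _ _ _ t0 t1 Eq Ep); apply/negP; rewrite -ltNge.
rewrite -subr_gt0 /prox_objective /=.
set A := (X in 0 < X).
have -> : A = - (t * (D + t * N / 2)).
  by rewrite /A /D /N !dotE (dotC p.1 x) (dotC q.1 x) (dotC q.1 p.1); field.
rewrite oppr_gt0 pmulr_rlt0 //.
have tN : t * N <= - D.
  rewrite /t -mulrA ler_piMr ?oppr_ge0 ?(ltW D0) //.
  by rewrite mulrC ler_pdivrMr //; lra.
lra.
Qed.

Definition affine_minorant phi : Prop :=
  exists a b, forall y, ((dot a y + b)%:E <= phi y)%E.

Lemma affine_minorant_neqNy {phi} y : affine_minorant phi -> phi y != -oo%E.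
Proof.
by case=> a [b hab]; apply: contraTneq (hab y) => ->; rewrite leNgt ltNyr.
Qed.

(** The subgradient inequality is an affine minorant as soon as [phi x] is
finite, which it is because [phi] is not identically +oo. *)
Lemma subdifferential_affine_minorant phi x a :
  proper_function phi -> subdifferential phi x a -> affine_minorant phi.
Proof.
move=> [nphi [z zdom]] sub; rewrite /dom /= in zdom.
have : (phi x < +oo)%E.
  rewrite ltey; apply/eqP => phix; have := sub z.
  by rewrite phix addye // leye_eq => /eqP zoo; rewrite zoo in zdom.
case phix : (phi x) (nphi x) => [r| |] // _ _.
exists a, (r - dot a x) => y; have := sub y; rewrite phix -EFinD.
by congr (_%:E <= _)%E; rewrite !dotE; ring.
Qed.

(** The inclusion (x - p) / c \in subdifferential phi p for the proximal point p,
written against all epigraph points so as to involve only real numbers. *)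
Lemma prox_variational phi (c : R) x : 0 < c ->
    closed (epigraph phi) -> convex_pairs (epigraph phi) ->
    dom phi !=set0 -> affine_minorant phi ->
  let p := prox (fun y => (c%:E * phi y)%E) x in
  phi p \is a fin_num /\
  forall q, epigraph phi q ->
    c * fine (phi p) + dot (x - p) (q.1 - p) <= c * q.2.
Proof.
move=> c0 clE cE [z0 z0dom] minor p.
have notNy y := affine_minorant_neqNy y minor; have [a [b hab]] := minor.
have finphi y : (phi y < +oo)%E -> phi y = (fine (phi y))%:E.
  by move=> yoo; rewrite fineK // fin_numE notNy -ltey.
have epi y : (phi y < +oo)%E -> epigraph phi (y, fine (phi y)).
  by move=> /finphi yfin; rewrite /epigraph /= -yfin.
pose h y : \bar R := (c%:E * phi y + (2^-1 * enorm (y - x) ^+ 2)%:E)%E.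
have hE y : (phi y < +oo)%E ->
    h y = (prox_objective c x (y, fine (phi y)))%:E.
  by move=> /finphi yfin; rewrite /h yfin /= -EFinM -EFinD enorm_sqr.
have [[y t] Eyt miny] : exists2 q, epigraph phi q &
    forall r, epigraph phi r -> prox_objective c x q <= prox_objective c x r.
  apply: prox_objective_min => //.
    by exists (z0, fine (phi z0)); apply: epi.
  exists (c *: a), (c * b) => q Eq; rewrite dotZl -mulrDr ler_pM2l //.
  by rewrite -lee_fin; apply: le_trans (hab _) Eq.
have pmin : forall z, (h p <= h z)%E.
  apply: (@xgetPex _ 0 (argmin h)); exists y => z; rewrite -/(h y) -/(h z).
  have [zoo|] := ltP (phi z) +oo%E; last first.
    rewrite leye_eq => /eqP zoo.
    by rewrite /h zoo gt0_muley ?lte_fin // addye // leey.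
  rewrite (hE z) //; have yoo : (phi y < +oo)%E.
    by apply: le_lt_trans Eyt _; rewrite ltry.
  rewrite (hE y) // lee_fin; apply: le_trans (miny _ (epi _ zoo)).
  rewrite /prox_objective /= lerD2r ler_pM2l //.
  by rewrite -lee_fin -finphi.
have poo : (phi p < +oo)%E.
  have := pmin z0; rewrite (hE z0 z0dom) ltey; apply: contraTneq => poo.
  by rewrite /h poo gt0_muley ?lte_fin // addye // leye_eq.
split; first by rewrite fin_numE notNy -ltey.
apply: (@prox_objective_variational _ _ _ (p, _)) cE (epi _ poo) _.
move=> [z s] Ezs; have zoo : (phi z < +oo)%E.
  by apply: le_lt_trans Ezs _; rewrite ltry.
rewrite -lee_fin -(hE p) //; apply: (le_trans (pmin z)).
rewrite (hE z) // lee_fin /prox_objective /= lerD2r ler_pM2l //.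
by rewrite -lee_fin -finphi.
Qed.

Lemma epigraph_conjugateP g u (s : R) :
  epigraph (conjugate g) (u, s) <->
  forall z, ((dot u z)%:E - g z <= s%:E)%E.
Proof.
split=> [Eus z|h]; last by apply: ge_ereal_sup => _ [z _ <-].
by apply: le_trans Eus; apply: ereal_sup_ubound; exists z.
Qed.

(** The epigraph of a conjugate is an intersection of closed half-spaces indexed
by the epigraph of [g]; this gives both its convexity and its closedness. *)
Lemma epigraph_conjugate_halfspace g u (s : R) : (forall z, g z != -oo%E) ->
  epigraph (conjugate g) (u, s) <->
  forall q, epigraph g q -> dot u q.1 - s <= q.2.
Proof.
move=> gNy; rewrite epigraph_conjugateP; split=> h.
  move=> [z r] /= Eq; have := h z; rewrite /epigraph /= in Eq.
  case gz : (g z) (gNy z) Eq => [r'| |] //= _.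
  by rewrite lee_fin -EFinB lee_fin => *; lra.
move=> z; case gz : (g z) (gNy z) => [r| |] //= _; last by rewrite leNye.
have /h /= : epigraph g (z, r) by rewrite /epigraph /= gz.
by rewrite -EFinB lee_fin => *; lra.
Qed.

Lemma conjugate_epigraph_convex g :
  (forall z, g z != -oo%E) -> convex_pairs (epigraph (conjugate g)).
Proof.
move=> gNy [u s] [v r] t t0 t1.
rewrite !epigraph_conjugate_halfspace //= => hu hv q Eq.
by have := hu q Eq; have := hv q Eq; rewrite !dotE; nra.
Qed.

Lemma conjugate_epigraph_closed g :
  (forall z, g z != -oo%E) -> closed (epigraph (conjugate g)).
Proof.
move=> gNy.
have -> : epigraph (conjugate g) =
    \bigcap_(q in epigraph g) [set w : V * R | dot w.1 q.1 - w.2 <= q.2].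
  by apply/seteqP; split=> -[u s]; rewrite epigraph_conjugate_halfspace.
apply: closed_bigI => q _.
apply: (@closed_comp _ _ (fun w : V * R => dot w.1 q.1 - w.2) [set r | r <= q.2]);
  last exact: closed_le.
move=> w _; apply: cvgB; last exact: cvg_snd.
by apply: cvg_dot; [exact: cvg_fst|exact: cvg_cst].
Qed.

Lemma conjugate_affine_minorant g :
  proper_function g -> affine_minorant (conjugate g).
Proof.
move=> [gNy [z zdom]]; rewrite /dom /= in zdom.
case gz : (g z) (gNy z) zdom => [r| |] // _ _.
exists z, (- r) => u; apply: ereal_sup_ubound; exists z => //.
by rewrite gz dotC EFinD.
Qed.
End prox.

(** * Averages along sequences *)

Section ergodic.
Context {R : realType} {n : nat}.
Local Notation V := 'rV[R]_n.

(** Jensen's inequality: the mean of the first K + 1 points is the convex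
combination of the mean of the first K and the last, with weight K / (K + 1). *)
Lemma ergodic_mean_in_convex (E : set (V * R)) (z : nat -> V) (s : nat -> R) K :
    convex_pairs E -> (1 <= K)%N -> (forall k, E (z k.+1, s k.+1)) ->
  E (ergodic_mean z K, K%:R^-1 * \sum_(1 <= k < K.+1) s k).
Proof.
move=> cE + Es; elim: K => // -[_ _|K IH _].
  by rewrite /ergodic_mean invr1 scale1r mul1r !big_nat1.
pose t : R := K.+1%:R / K.+2%:R.
have t0 : 0 < t by rewrite divr_gt0.
have t1 : t < 1 by rewrite ltr_pdivrMr // mul1r ltr_nat.
have := cE _ _ _ t0 t1 (IH isT) (Es K.+1).
have ->: 1 - t = K.+2%:R^-1.
  rewrite /t -[X in X - _](@divff _ (K.+2%:R : R)) ?pnatr_eq0 // -mulrBl.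
  by rewrite -natrB // subSnn mul1r.
rewrite /ergodic_mean /= scalerA mulrA /t mulrAC divff ?pnatr_eq0 // div1r.
by rewrite -scalerDr -mulrDr -!big_nat_recr.
Qed.

(** The sharpened telescoping bound. Induction peels off the first term and
applies the hypothesis to the shifted sequence, which leaves
<r_0 - r_1, r_1> + K / (2 (K + 1)) |r_1|^2 <= (K + 1) / (2 (K + 2)) |r_0|^2;
the difference of the two sides is a multiple of
|(K + 1) r_0 - (K + 2) r_1|^2. *)
Lemma sum_dot_increments_le (r : nat -> V) K :
  \sum_(0 <= k < K) dot (r k - r k.+1) (r k.+1) <=
    K%:R / (2 * K.+1%:R) * dot (r 0) (r 0).
Proof.
elim: K r => [r|K IH r]; first by rewrite big_geq // !mul0r.
rewrite big_nat_recl //; have := IH (fun k => r k.+1) => {}IH.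
apply: (le_trans (lerD (lexx _) IH)); rewrite -subr_ge0.
set k1 : R := K.+1%:R; set k2 : R := K.+2%:R.
have k10 : 0 < k1 by []. have k20 : 0 < k2 by [].
have -> : K%:R = k1 - 1 :> R by rewrite /k1 -natr1 addrK.
have k2E : k2 = k1 + 1 by rewrite /k1 /k2 natr1.
clearbody k1 k2; subst k2.
set X := (X in 0 <= X).
have -> : X = (2 * k1 * (k1 + 1))^-1 *
              dot (k1 *: r 0 - (k1 + 1) *: r 1)
                                  (k1 *: r 0 - (k1 + 1) *: r 1).
  by rewrite /X !dotE (dotC (r 1) (r 0)); field; rewrite !gt_eqF.
by rewrite mulr_ge0 ?dot_ge0 // invr_ge0 ltW // !mulr_gt0.
Qed.
End ergodic.

(** * The primal-dual gap *)

Section gap.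
Context {R : realType} {n : nat}.
Local Notation V := 'rV[R]_n.

Lemma dot_ergodic_mean (w : V) (z : nat -> V) K :
  dot w (ergodic_mean z K) = K%:R^-1 * \sum_(1 <= k < K.+1) dot w (z k).
Proof.
rewrite dotZr; congr (_ * _).
apply: (big_morph (dot w)) => [b c|]; first exact: dotDr.
by rewrite -[0](scale0r 0) dotZr mul0r.
Qed.

(** One Douglas-Rachford step from (x, u) to (x', u'). The hypotheses are the
optimality conditions of the two proximal steps, tested at y and v; a^-1 times
the first plus a times the second is the conclusion, because the extrapolated
point 2 u' - u cancels the terms that couple x' and u'. *)
Lemma drs_step_gap (a : R) (x u x' u' y v : V) (fx fy gu gv : R) : 0 < a ->
    a * fx + dot (x - a *: (2 *: u' - u) - x') (y - x') <= a * fy ->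
    a^-1 * gu + dot (u + a^-1 *: x - u') (v - u') <= a^-1 * gv ->
  fx + gu + dot v x' - dot y u' - (fy + gv) <=
  a^-1 * dot (x - y + a *: (u - v) - (x' - y + a *: (u' - v)))
             (x' - y + a *: (u' - v)).
Proof.
move=> a0; rewrite -subr_ge0 => hx; rewrite -subr_ge0 => hu.
rewrite -subr_ge0.
have ia0 : 0 < a^-1 by rewrite invr_gt0.
have := addr_ge0 (mulr_ge0 (ltW ia0) hx) (mulr_ge0 (ltW a0) hu).
(* Orient every product of two vectors the same way for [field]. *)
congr (0 <= _); rewrite !dotE.
rewrite !(dotC v) !(dotC y) !(dotC u') !(dotC x') !(dotC u).
by field; rewrite gt_eqF.
Qed.
End gap.

Theorem theorem3p2 (R : realType) (n : nat) (f g : 'rV[R]_n -> \bar R)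
    (hf : closed_convex_proper f) (hg : closed_convex_proper g)
    (hsol : exists xs us : 'rV[R]_n,
       [set v + us | v in subdifferential f xs] 0 /\
       [set v - xs | v in subdifferential (conjugate g) us] 0)
    (alpha : R) (halpha : 0 < alpha) (x u : nat -> 'rV[R]_n)
    (hu : forall k : nat,
       u k.+1 = prox (fun v => (alpha^-1%:E * conjugate g v)%E)
                     (u k + alpha^-1 *: x k))
    (hx : forall k : nat,
       x k.+1 = prox (fun y => (alpha%:E * f y)%E)
                     (x k - alpha *: (2 *: u k.+1 - u k)))
    (K : nat) (hK : (1 <= K)%N) (y v : 'rV[R]_n)
    (hy : dom f y) (hv : dom (conjugate g) v) :
  (lagrangian f g (ergodic_mean x K) v - lagrangian f g y (ergodic_mean u K)
   <= (1 / (alpha * K.+1%:R)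
       * (enorm (x 0%N - y) ^+ 2 + alpha ^+ 2 * enorm (u 0%N - v) ^+ 2))%:E)%E.
Proof.
have [clf cvf propf] := hf; have [clg cvg propg] := hg.
have gNy := propg.1.
have cEf := epigraph_convex _ cvf.
have cEg := conjugate_epigraph_convex _ gNy.
have clEg := conjugate_epigraph_closed _ gNy.
have mf : affine_minorant f.
  case: hsol => xs [us [[w wsub _] _]].
  exact: subdifferential_affine_minorant propf wsub.
have mg := conjugate_affine_minorant _ propg.
have stepf k : f (x k.+1) \is a fin_num /\ forall q, epigraph f q ->
    alpha * fine (f (x k.+1)) +
      dot (x k - alpha *: (2 *: u k.+1 - u k) - x k.+1) (q.1 - x k.+1)
    <= alpha * q.2.
  by rewrite [in x k.+1]hx; apply: prox_variational => //; exists y.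
have stepg k : conjugate g (u k.+1) \is a fin_num /\
    forall q, epigraph (conjugate g) q ->
    alpha^-1 * fine (conjugate g (u k.+1)) +
      dot (u k + alpha^-1 *: x k - u k.+1) (q.1 - u k.+1)
    <= alpha^-1 * q.2.
  rewrite [in u k.+1]hu; apply: prox_variational => //; last by exists v.
  by rewrite invr_gt0.
pose ft k := fine (f (x k)); pose gst k := fine (conjugate g (u k)).
have Ef : epigraph f (ergodic_mean x K, K%:R^-1 * \sum_(1 <= k < K.+1) ft k).
  apply: ergodic_mean_in_convex => // k.
  by rewrite /epigraph /= /ft fineK //; case: (stepf k).
have Eg : epigraph (conjugate g)
    (ergodic_mean u K, K%:R^-1 * \sum_(1 <= k < K.+1) gst k).
  apply: ergodic_mean_in_convex => // k.
  by rewrite /epigraph /= /gt fineK //; case: (stepg k).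
rewrite /dom /= in hy hv.
case fyE : (f y) (affine_minorant_neqNy y mf) hy => [fy| |] // _ _.
case gvE : (conjugate g v) (affine_minorant_neqNy v mg) hv => [gv| |] // _ _.
rewrite /lagrangian fyE gvE; move: Ef Eg; rewrite /epigraph /=.
case: (f _) (affine_minorant_neqNy (ergodic_mean x K) mf) => [fm| |] //= _.
case: (conjugate g _) (affine_minorant_neqNy (ergodic_mean u K) mg)
  => [gm| |] //= _.
rewrite !lee_fin => hfm hgm.
rewrite !enorm_sqr.
pose r k := x k - y + alpha *: (u k - v).
have gap k : ft k.+1 + gst k.+1 + dot v (x k.+1) - dot y (u k.+1) - (fy + gv)
    <= alpha^-1 * dot (r k - r k.+1) (r k.+1).
  apply: drs_step_gap => //.
    by apply: (stepf k).2 (y, fy) _; rewrite /epigraph /= fyE.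
  by apply: (stepg k).2 (v, gv) _; rewrite /epigraph /= gvE.
have K0 : 0 < K%:R :> R by rewrite ltr0n.
have sumgap : K%:R * (K%:R^-1 * (\sum_(1 <= k < K.+1) ft k) +
      K%:R^-1 * (\sum_(1 <= k < K.+1) gst k) + dot v (ergodic_mean x K)
      - dot y (ergodic_mean u K) - (fy + gv)) <=
    alpha^-1 * (K%:R / (2 * K.+1%:R) * dot (r 0) (r 0)).
  have ia0 : 0 < alpha^-1 by rewrite invr_gt0.
  apply: le_trans (ler_wpM2l (ltW ia0) (sum_dot_increments_le r K)).
  rewrite [leRHS]mulr_sumr; pose G k := ft k.+1 + gst k.+1 + dot v (x k.+1)
    - dot y (u k.+1) - (fy + gv).
  apply: (@le_trans _ _ (\sum_(0 <= k < K) G k)); last first.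
    by apply: ler_sum => k _; exact: gap.
  rewrite /G.
  rewrite !dot_ergodic_mean !mulrDr !mulrN !mulVKf ?gt_eqF //.
  rewrite !big_add1 /= !big_split /= !sumrN sumr_const_nat subn0.
  by rewrite -[(_ + _) *+ K]mulr_natl mulrDr.
(* |p + q|^2 <= 2 |p|^2 + 2 |q|^2, the slack being |p - q|^2. *)
have r0 : dot (r 0) (r 0) <=
    2 * (dot (x 0 - y) (x 0 - y) + alpha ^+ 2 * dot (u 0 - v) (u 0 - v)).
  have := dot_ge0 (x 0 - y - alpha *: (u 0 - v)); rewrite /r.
  move: (x 0 - y) (u 0 - v) => p q; rewrite !dotE (dotC q p); nra.
move: sumgap; rewrite mulrC -ler_pdivlMr // => sumgap.
apply: (@le_trans _ _
  (alpha^-1 * (K%:R / (2 * K.+1%:R) * dot (r 0) (r 0)) / K%:R)).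
  by apply: le_trans sumgap; rewrite (dotC _ y); lra.
have -> : alpha^-1 * (K%:R / (2 * K.+1%:R) * dot (r 0) (r 0)) / K%:R =
    1 / (alpha * K.+1%:R) * (2^-1 * dot (r 0) (r 0)).
  have : K.+1%:R != 0 :> R by [].
  by move: (K.+1%:R) => k1 k10; field; rewrite k10 !gt_eqF.
rewrite ler_pM2l ?divr_gt0 ?mulr_gt0 //; lra.
Qed.
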